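(* Let $A$ be a finite dimensional commutative unital local $K$-algebra with a fixed augmentation $\epsilon$, let $\lambda$ be a deformation of a dialgebra $D$ with base $A$, and let $0\to K\xrightarrow{i}B\xrightarrow{p}A\to0$ be an extension of $A$ corresponding to a cohomology class $f\in H^2_{Harr}(A;K)$. Then $HY^2(D,D)$ operates transitively (by the operation described in the context) on the set of equivalence classes of deformations $\mu$ of $D$ with base $B$ such that $p_*\mu=\lambda$.
   Context: $K$ is a field of characteristic zero; tensor products are over $K$ unless indicated. Dialgebra: a $K$-vector space $D$ with two $K$-bilinear products $\dashv,\vdash$ such that for all $x,y,z$: $x\dashv(y\dashv z)=(x\dashv y)\dashv z=x\dashv(y\vdash z)$; $(x\vdash y)\dashv z=x\vdash(y\dashv z)$; $(x\dashv y)\vdash z=x\vdash(y\vdash z)=(x\vdash y)\vdash z$. Trees: $Y_n$ is the set of planar binary rooted trees with $n$ trivalent vertices and $n+1$ leaves labelled $0,\dots,n$ from left to right; $Y_0=\{|\}$, and $|$ is denoted $[0]$; $[1]$ is the unique element of $Y_1$. The grafting $y_1\vee y_2$ of a $p$-tree and a $q$-tree joins their roots to a new root; it is denoted $[y_1\; p{+}q{+}1\; y_2]$ with zeros deleted. Thus $[12]=[1]\vee|$, $[21]=|\vee[1]$. The face map $d_i:Y_n\to Y_{n-1}$ deletes the $i$-th leaf. Cohomology: $CY^n(D,D)=\mathrm{Hom}_K(K[Y_n]\otimes D^{\otimes n},D)$, with coboundary $\delta=\sum_{i=0}^{n+1}(-1)^i\delta^i$, where for $y\in Y_{n+1}$: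 $(\delta^0f)(y;a_1,\dots,a_{n+1})=a_1\circ_0^y f(d_0y;a_2,\dots,a_{n+1})$; $(\delta^if)(y;a_1,\dots,a_{n+1})=f(d_iy;a_1,\dots,a_i\circ_i^ya_{i+1},\dots,a_{n+1})$ for $1\le i\le n$; $(\delta^{n+1}f)(y;a_1,\dots,a_{n+1})=f(d_{n+1}y;a_1,\dots,a_n)\circ_{n+1}^ya_{n+1}$. Here $\circ_0^y=\dashv$ if $y=|\vee y_1$ for some $y_1$, and $\vdash$ otherwise; for $1\le i\le n$, $\circ_i^y=\dashv$ if the $i$-th leaf is oriented like $\backslash$ and $\vdash$ if it is oriented like $/$; $\circ_{n+1}^y=\vdash$ if $y=y_1\vee|$ for some $y_1$, and $\dashv$ otherwise. $HY^n(D,D)$ is the resulting cohomology. Deformations: let $A$ be a commutative unital $K$-algebra with augmentation $\epsilon:A\to K$, $\epsilon(1)=1$. A deformation $\lambda$ of $D$ with base $A$ is a dialgebra structure on $A\otimes D$ with $A$-bilinear products $\dashv_\lambda,\vdash_\lambda$ such that $\epsilon\otimes\mathrm{id}:A\otimes D\to D$ is a dialgebra morphism. Two deformations with the same base $A$ are equivalent if there is an $A$-linear dialgebra isomorphism between them compatible with $\epsilon\otimes\mathrm{id}$. For a unital homomorphism $\phi:A\to A'$ with $\epsilon'\circ\phi=\epsilon$, the push-out $\phi_*\lambda$ is the deformation with base $A'$ on $A'\otimes D=A'\otimes_A(A\otimes D)$ given by $(a_1'\otimes_A l_1)*_{\phi_*\lambda}(a_2'\otimes_A l_2)=a_1'a_2'\otimes_A(l_1*_\lambda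 l_2)$, $*\in\{\dashv,\vdash\}$. Extensions: $K$ is an $A$-module via $\epsilon$. Elements of the Harrison cohomology $H^2_{Harr}(A;K)$ are in bijection with isomorphism classes of extensions $0\to K\xrightarrow{i}B\xrightarrow{p}A\to0$ of commutative algebras with $b\,i(k)=i(\epsilon(p(b))k)$. Then $B$ is local and unital, with augmentation $\widehat\epsilon=\epsilon\circ p$. The operation: put $I=i\otimes\mathrm{id}:D\to B\otimes D$ and $E=\widehat\epsilon\otimes\mathrm{id}:B\otimes D\to D$. If $\mu$ is a deformation of $D$ with base $B$ with $p_*\mu=\lambda$ and $\psi\in CY^2(D,D)$ is a cocycle, the class of $\psi$ sends the class of $\mu$ to the class of the deformation $\mu^\psi$ with products $l_1\dashv_{\mu^\psi}l_2=l_1\dashv_\mu l_2+I\psi([21];E(l_1),E(l_2))$ and $l_1\vdash_{\mu^\psi}l_2=l_1\vdash_\mu l_2+I\psi([12];E(l_1),E(l_2))$ for $l_1,l_2\in B\otimes D$. *)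

(* Defs.v *)
From HB Require Import structures.
From mathcomp Require Import all_boot all_algebra.
From mathcomp Require Import boolp classical_sets functions.
From mathcomp Require Import freeg.

Set Implicit Arguments.
Unset Strict Implicit.
Unset Printing Implicit Defensive.

Import GRing.Theory.

Local Open Scope ring_scope.
Local Open Scope quotient_scope.

Section LmodQuotient.
Variables (K : nzRingType) (V : lmodType K) (S : submodClosed V).

Lemma submod_zmod_closed : zmod_closed S.
Proof.
split=> [|u v uS vS]; first exact: rpred0.
by rewrite -scaleN1r rpredD // rpredZ.
Qed.

Definition submod_zmod : {pred V} := fun v => v \in S.
HB.instance Definition _ :=
  GRing.isZmodClosed.Build V submod_zmod submod_zmod_closed.

Definition lmod_quot : Type := Quotient.quot submod_zmod.
HB.instance Definition _ := GRing.Zmodule.on lmod_quot.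
HB.instance Definition _ := Quotient.on lmod_quot.

Definition lmod_pi : V -> lmod_quot := \pi_(Quotient.quot submod_zmod).

Lemma lmod_pi_eq u v : (lmod_pi u = lmod_pi v) <-> (u - v \in S).
Proof.
rewrite -[u - v \in S]/(u - v \in submod_zmod) Quotient.idealrBE.
by split=> /eqP.
Qed.

Lemma lmod_piK (x : lmod_quot) : lmod_pi (repr x) = x.
Proof. exact: reprK. Qed.

Lemma lmod_piD u v : lmod_pi (u + v) = lmod_pi u + lmod_pi v.
Proof. exact: (raddfD \pi_(Quotient.quot submod_zmod)). Qed.

Definition quot_scale (a : K) (x : lmod_quot) : lmod_quot :=
  lmod_pi (a *: repr x).

Lemma pi_scale a v : lmod_pi (a *: v) = quot_scale a (lmod_pi v).
Proof.
apply/lmod_pi_eq; rewrite -scalerBr rpredZ //.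
by apply/lmod_pi_eq; rewrite lmod_piK.
Qed.

Lemma quot_scalerA a b x :
  quot_scale a (quot_scale b x) = quot_scale (a * b) x.
Proof. by rewrite -[x]lmod_piK -!pi_scale scalerA. Qed.

Lemma quot_scale1r : left_id 1 quot_scale.
Proof. by move=> x; rewrite -[x]lmod_piK -pi_scale scale1r. Qed.

Lemma quot_scalerDr : right_distributive quot_scale +%R.
Proof.
move=> a x y; rewrite -[x]lmod_piK -[y]lmod_piK.
by rewrite -lmod_piD -!pi_scale -lmod_piD scalerDr.
Qed.

Lemma quot_scalerDl x : {morph quot_scale^~ x : a b / a + b}.
Proof.
by move=> a b; rewrite -[x]lmod_piK -!pi_scale -lmod_piD scalerDl.
Qed.

HB.instance Definition _ := GRing.Zmodule_isLmodule.Build K lmod_quot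
  quot_scalerA quot_scale1r quot_scalerDr quot_scalerDl.

Lemma lmod_pi_linear : linear lmod_pi.
Proof. by move=> a u v; rewrite lmod_piD pi_scale. Qed.
HB.instance Definition _ :=
  GRing.isLinear.Build K V lmod_quot _ lmod_pi lmod_pi_linear.

End LmodQuotient.

Local Notation bilinear f := (bilinear_for *:%R *:%R f).

Section FreeModule.
Variables (K : nzRingType) (T : choiceType) (W : lmodType K) (f : T -> W).

Lemma fglift_linear : linear (fglift f : {freeg T / K} -> W).
Proof.
have fgB := lift_is_additive f.
pose g : {additive {freeg T / K} -> W} :=
  HB.pack (fglift f) (GRing.isZmodMorphism.Build _ _ _ fgB).
move=> a u v; rewrite -[fglift f]/(g : _ -> _) raddfD; congr (_ + _).
rewrite -[a *: u]/(fgscale a u) raddf_sum -[in RHS](freeg_sumE u) raddf_sum.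
by rewrite scaler_sumr; apply: eq_bigr => x _; rewrite /= !liftU scalerA.
Qed.

End FreeModule.

Section Tensor.
Variables (K : fieldType) (U V : lmodType K).

Local Notation free := {freeg (U * V)%type / K}.

Inductive tens_null : free -> Prop :=
| TensNullAddl u u' v :
    tens_null (<< (u + u', v) >> - (<< (u, v) >> + << (u', v) >>))
| TensNullAddr u v v' :
    tens_null (<< (u, v + v') >> - (<< (u, v) >> + << (u, v') >>))
| TensNullScalel (k : K) u v :
    tens_null (<< (k *: u, v) >> - k *: << (u, v) >>)
| TensNullScaler (k : K) u v :
    tens_null (<< (u, k *: v) >> - k *: << (u, v) >>)
| TensNull0 : tens_null 0
| TensNullLin (k : K) x y : tens_null x -> tens_null y -> tens_null (k *: x + y).

Definition tens_null_pred : {pred free} := fun x => `[< tens_null x >].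

Lemma tens_null_submod : submod_closed tens_null_pred.
Proof.
split=> [|k x y /asboolP ? /asboolP ?]; apply/asboolP.
  exact: TensNull0.
exact: TensNullLin.
Qed.
HB.instance Definition _ :=
  GRing.isSubmodClosed.Build K free tens_null_pred tens_null_submod.

Definition tensor : Type := lmod_quot tens_null_pred.
HB.instance Definition _ := GRing.Lmodule.on tensor.

Definition tens (u : U) (v : V) : tensor :=
  lmod_pi tens_null_pred << (u, v) >>.

Lemma tens_bilinear : bilinear tens.
Proof.
split=> [v k u u'|u k v v'] /=; rewrite /tens.
  have -> : k *: lmod_pi tens_null_pred << (u, v) >>
          = lmod_pi tens_null_pred << (k *: u, v) >>.
    by rewrite -linearZ /=; apply/esym/lmod_pi_eq/asboolP/TensNullScalel.
  by rewrite -linearD; apply/lmod_pi_eq/asboolP/TensNullAddl.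
have -> : k *: lmod_pi tens_null_pred << (u, v) >>
        = lmod_pi tens_null_pred << (u, k *: v) >>.
  by rewrite -linearZ /=; apply/esym/lmod_pi_eq/asboolP/TensNullScaler.
by rewrite -linearD; apply/lmod_pi_eq/asboolP/TensNullAddr.
Qed.

Lemma tens_ind (P : tensor -> Prop) :
  P 0 -> (forall u v x, P x -> P (tens u v + x)) -> forall x, P x.
Proof.
move=> P0 PD x; rewrite -[x]lmod_piK; move: (repr x) => {x} y.
rewrite -[y]freeg_sumE; elim: (dom y) => [|[u v] s IHs].
  by rewrite big_nil linear0.
rewrite big_cons linearD /=.
have -> : << coeff (u, v) y *g (u, v) >>
        = coeff (u, v) y *: << (u, v) >> :> free.
  by apply/eqP/freeg_eqP => z; rewrite coeffZ !coeffU mul1r.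
rewrite linearZ /= -[_ *: _]addr0.
have [tl _] := tens_bilinear.
have tZ k u' : tens (k *: u') v = k *: tens u' v.
  have t0 : tens 0 v = 0.
    by have := tl v (-1) 0 0; rewrite /= scaler0 addr0 scaleN1r addNr.
  by have /= := tl v k u' 0; rewrite addr0 t0 addr0.
by rewrite addr0 -[lmod_pi _ _]/(tens u v) -tZ; apply: PD.
Qed.

(* The linear map induced by a bilinear map [f]; it is only meaningful when [f]
   is bilinear, see [tens_liftE] and [tens_lift_linear]. *)
Definition tens_lift (W : lmodType K) (f : U -> V -> W) (x : tensor) : W :=
  fglift (fun uv => f uv.1 uv.2) (repr x).

Section Lift.
Variables (W : lmodType K) (f : U -> V -> W).
Hypothesis fP : bilinear f.

Let F : {freeg (U * V)%type / K} -> W := fglift (fun uv => f uv.1 uv.2).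

Let FL : {linear free -> W} :=
  HB.pack F (GRing.isLinear.Build K free W _ F (fglift_linear _)).

Let FU u v : F << (u, v) >> = f u v.
Proof. by rewrite /F liftU scale1r. Qed.

Let F_null x : tens_null x -> F x = 0.
Proof.
have [fl fr] := fP.
have f0l v : f 0 v = 0.
  by have := fl v (-1) 0 0; rewrite /= scaler0 addr0 scaleN1r addNr.
have f0r u : f u 0 = 0.
  by have := fr u (-1) 0 0; rewrite /= scaler0 addr0 scaleN1r addNr.
rewrite -[F]/(FL : _ -> _).
elim=> {x} [u u' v|u v v'|k u v|k u v||k x y _ IHx _ IHy].
- rewrite linearB linearD /= !FU; have /= := fl v 1 u u'.
  by rewrite !scale1r => ->; rewrite subrr.
- rewrite linearB linearD /= !FU; have /= := fr u 1 v v'.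
  by rewrite !scale1r => ->; rewrite subrr.
- rewrite linearB linearZ /= !FU; have /= := fl v k u 0.
  by rewrite f0l !addr0 => ->; rewrite subrr.
- rewrite linearB linearZ /= !FU; have /= := fr u k v 0.
  by rewrite f0r !addr0 => ->; rewrite subrr.
- by rewrite linear0.
- by rewrite linearP IHx IHy scaler0 addr0.
Qed.

Let lift_pi x : tens_lift f (lmod_pi tens_null_pred x) = F x.
Proof.
apply/eqP; rewrite -subr_eq0 -[tens_lift f _]/(F _) -[F]/(FL : _ -> _) -linearB.
apply/eqP/F_null; set y := _ - _.
suff: y \in tens_null_pred by move/asboolP.
by apply/lmod_pi_eq; rewrite lmod_piK.
Qed.

Lemma tens_liftE u v : tens_lift f (tens u v) = f u v.
Proof. by rewrite lift_pi FU. Qed.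

Lemma tens_lift_linear : linear (tens_lift f).
Proof.
move=> k x y; rewrite -[x]lmod_piK -[y]lmod_piK -linearP !lift_pi.
exact: (linearP FL).
Qed.

End Lift.

End Tensor.

Arguments tens {K U V}.

Section Algebras.
Variables (K : fieldType).

Definition finite_dimensional (V : lmodType K) : Prop :=
  exists n, inhabited (Vector.axiom n V).

Section Local.
Variable A : comAlgType K.
Local Open Scope classical_set_scope.

Definition ideal (I : set A) : Prop :=
  [/\ I 0, forall x y, I x -> I y -> I (x + y) & forall a x, I x -> I (a * x)].

Definition maximal_ideal (I : set A) : Prop :=
  [/\ ideal I, ~ I 1 & forall J : set A, ideal J -> ~ J 1 -> I `<=` J -> J = I].

Definition is_local : Prop := exists! I : set A, maximal_ideal I.

End Local.

(* [eps] is the augmentation of [A].  Taking [B] and [p] unital loses nothing: any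
   commutative algebra extension satisfying these conditions has a unit, which
   [p] maps to 1. *)
Definition is_extension (A B : comAlgType K) (eps : {lrmorphism A -> K^o})
    (i : {linear K^o -> B}) (p : {lrmorphism B -> A}) : Prop :=
  [/\ injective i,
      forall b, p b = 0 <-> exists k, b = i k,
      forall a, exists b, p b = a
    & forall b k, b * i k = i (eps (p b) * k)].

End Algebras.

Reserved Notation "x ⊣[ D ] y" (at level 40, left associativity,
  format "x  ⊣[ D ]  y").
Reserved Notation "x ⊢[ D ] y" (at level 40, left associativity,
  format "x  ⊢[ D ]  y").

Record dialgebra (K : fieldType) (D : lmodType K) := Dialgebra {
  ldash : D -> D -> D;
  rdash : D -> D -> D;
  ldash_bilinear : bilinear ldash;
  rdash_bilinear : bilinear rdash;
  ldashA : forall x y z, ldash x (ldash y z) = ldash (ldash x y) z;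
  ldash_bar : forall x y z, ldash (ldash x y) z = ldash x (rdash y z);
  dashA : forall x y z, ldash (rdash x y) z = rdash x (ldash y z);
  rdash_bar : forall x y z, rdash (ldash x y) z = rdash x (rdash y z);
  rdashA : forall x y z, rdash x (rdash y z) = rdash (rdash x y) z
}.

Notation "x ⊣[ D ] y" := (ldash D x y).
Notation "x ⊢[ D ] y" := (rdash D x y).

Definition dialg_morphism (K : fieldType) (D E : lmodType K)
    (dD : dialgebra D) (dE : dialgebra E) (f : D -> E) : Prop :=
  [/\ linear f,
      forall x y, f (x ⊣[dD] y) = f x ⊣[dE] f y
    & forall x y, f (x ⊢[dD] y) = f x ⊢[dE] f y].

Inductive tree := Leaf | Node of tree & tree.

Fixpoint nodes (t : tree) : nat :=
  if t is Node l r then (nodes l + nodes r).+1 else 0.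

Definition is_leaf (t : tree) : bool := if t is Leaf then true else false.

(* In [Node l r] the leaves of [l] are numbered 0, ..., nodes l, and leaf number
   j of [r] is leaf number nodes l + 1 + j of the whole tree. *)
Fixpoint del_leaf (i : nat) (t : tree) : tree :=
  if t is Node l r then
    if (i <= nodes l)%N then
      if is_leaf l then r else Node (del_leaf i l) r
    else
      if is_leaf r then l else Node l (del_leaf (i - (nodes l).+1) r)
  else Leaf.

Lemma nodes_del_leaf i t : nodes (del_leaf i t) = (nodes t).-1.
Proof.
elim: t i => //= l IHl r IHr i; case: ifP => _.
  by case: l IHl => //= l1 l2 ->.
by case: r IHr => [_|r1 r2 /= ->]; rewrite /= ?addn0 ?addnS.
Qed.

(* Trees grow upwards from the root, so that a leaf is oriented like \ when it is
   the left child of its vertex, and like / when it is the right child. *)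
Fixpoint left_leaning (i : nat) (t : tree) : bool :=
  if t is Node l r then
    if (i <= nodes l)%N then is_leaf l || left_leaning i l
    else ~~ is_leaf r && left_leaning (i - (nodes l).+1) r
  else false.

Definition left_trivial (t : tree) : bool :=
  if t is Node l _ then is_leaf l else false.
Definition right_trivial (t : tree) : bool :=
  if t is Node _ r then is_leaf r else false.

Definition Y (n : nat) : Type := {t : tree | nodes t == n}.

Lemma face_subproof n i (y : Y n.+1) : nodes (del_leaf i (sval y)) == n.
Proof. by rewrite nodes_del_leaf (eqP (svalP y)). Qed.

Definition face n (i : nat) (y : Y n.+1) : Y n :=
  exist (fun t => nodes t == n) _ (face_subproof i y).

Definition tree12 : Y 2 :=
  exist (fun t => nodes t == 2) (Node (Node Leaf Leaf) Leaf) isT.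
Definition tree21 : Y 2 :=
  exist (fun t => nodes t == 2) (Node Leaf (Node Leaf Leaf)) isT.

Section Cohomology.
Variables (K : fieldType) (D : lmodType K) (dD : dialgebra D).

Local Notation raw n := (Y n -> ('I_n -> D) -> D).

Definition multilinear n (f : raw n) : Prop :=
  forall y (j : 'I_n) (a : 'I_n -> D),
    linear (fun u => f y [eta a with j |-> u]).

Definition multilinear_pred n : {pred raw n} := fun f => `[< multilinear f >].

Lemma multilinear_submod n : submod_closed (@multilinear_pred n).
Proof.
split=> [|c f g /asboolP fP /asboolP gP]; apply/asboolP => y j a k u v /=.
  by rewrite scaler0 addr0.
rewrite -[LHS]/(c *: f _ _ + g _ _) fP gP.
rewrite -[(c *: f + g) _ _]/(c *: f _ _ + g _ _).
rewrite -[(c *: f + g) _ _]/(c *: f _ _ + g _ _).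
by rewrite !scalerDr !scalerA mulrC addrACA.
Qed.
HB.instance Definition _ n := GRing.isSubmodClosed.Build K (raw n)
  (@multilinear_pred n) (@multilinear_submod n).

(* Hom(K[Y_n] ⊗ D^{⊗n}, D), as families of n-linear maps indexed by Y_n. *)
Record CY n := Cochain {
  cochain_fun :> raw n;
  cochain_multilinear : cochain_fun \in @multilinear_pred n
}.
HB.instance Definition _ n := [isSub for @cochain_fun n].
HB.instance Definition _ n := [Choice of CY n by <:].
HB.instance Definition _ n := [SubChoice_isSubLmodule of CY n by <:].

Definition dash (left : bool) : D -> D -> D := if left then ldash dD else rdash dD.

Definition first_dash n (y : Y n) := dash (left_trivial (sval y)).
Definition leaf_dash n (i : nat) (y : Y n) := dash (left_leaning i (sval y)).
Definition last_dash n (y : Y n) := dash (~~ right_trivial (sval y)).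

Section Args.
Variables (n : nat) (a : 'I_n.+1 -> D).

(* With [a] standing for (a_1, ..., a_{n+1}), where a_k is [a (k - 1)]:
   the sequences (a_2, ..., a_{n+1}), (a_1, ..., a_n), and
   (a_1, ..., a_i o a_{i+1}, ..., a_{n+1}). *)
Definition drop_first : 'I_n -> D := fun j => a (fintype.lift ord0 j).
Definition drop_last : 'I_n -> D := fun j => a (fintype.lift ord_max j).
Definition contract (op : D -> D -> D) (i : nat) : 'I_n -> D := fun j =>
  if (j.+1 < i)%N then drop_last j
  else if j.+1 == i then op (drop_last j) (drop_first j)
  else drop_first j.

End Args.

Definition delta n (i : nat) (f : raw n) : raw n.+1 := fun y a =>
  if i == 0 then first_dash y (a ord0) (f (face 0 y) (drop_first a))
  else if (i <= n)%N then f (face i y) (contract a (leaf_dash i y) i)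
  else last_dash y (f (face n.+1 y) (drop_last a)) (a ord_max).

Definition coboundary_raw n (f : raw n) : raw n.+1 :=
  \sum_(i < n.+2) (-1) ^+ i *: delta i f.

Lemma dash_bilinear b : bilinear (dash b).
Proof. by case: b; [exact: ldash_bilinear | exact: rdash_bilinear]. Qed.

Lemma rawP n (k : K) (f g : raw n) y a : (k *: f + g) y a = k *: f y a + g y a.
Proof. by []. Qed.

Lemma delta_linear n i : linear (@delta n i).
Proof.
move=> k f g; apply/funext => y; apply/funext => a; rewrite rawP /delta.
case: ifP => _; first exact: (dash_bilinear _).2.
by case: ifP => _ //; exact: (dash_bilinear _).1.
Qed.

Lemma coboundary_raw_linear n : linear (@coboundary_raw n).
Proof.
move=> k f g; rewrite /coboundary_raw scaler_sumr -big_split /=.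
apply: eq_bigr => i _; rewrite delta_linear scalerDr.
by rewrite !scalerA [in LHS]mulrC.
Qed.

Lemma drop_first_with n (a : 'I_n.+1 -> D) (j : 'I_n.+1) u t :
  drop_first [eta a with j |-> u] t = if t.+1 == j :> nat then u else drop_first a t.
Proof. by rewrite /drop_first /= -val_eqE /= /bump. Qed.

Lemma drop_last_with n (a : 'I_n.+1 -> D) (j : 'I_n.+1) u t :
  drop_last [eta a with j |-> u] t = if t == j :> nat then u else drop_last a t.
Proof. by rewrite /drop_last /= -val_eqE /= /bump leqNgt ltn_ord. Qed.

Lemma contract_with n (a : 'I_n.+1 -> D) (j : 'I_n.+1) op i :
    bilinear op -> (0 < i <= n)%N ->
  exists j' : 'I_n, exists c : 'I_n -> D, exists2 g : D -> D, linear g &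
    forall u, contract [eta a with j |-> u] op i = [eta c with j' |-> g u].
Proof.
move=> [opl opr] /andP[i_gt0 i_len].
have [lt_ji|le_ij] := ltnP j i.
  have [jj jjE] : exists jj : 'I_n, jj = j :> nat.
    by exists (Ordinal (leq_trans lt_ji i_len)).
  exists jj, (contract a op i).
  exists (fun u => if (j.+1 == i)%N then op u (drop_first a jj) else u).
    by case: eqP => // _; exact: opl.
  move=> u; apply/funext => t /=; rewrite /contract drop_first_with drop_last_with.
  rewrite -val_eqE /= jjE; case: (ltngtP t.+1 i) => [lt_ti|lt_it|eq_ti].
  - by case: eqP => // eq_tj; rewrite -eq_tj ltn_eqF.
  - case: (t.+1 =P j) => [eq_tj|_]; first by rewrite eq_tj ltnNge ltnW in lt_it.
    by case: (t =P j :> nat) => // eq_tj; rewrite eq_tj ltnNge lt_ji in lt_it.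
  - rewrite -eq_ti in lt_ji *; rewrite eqSS [(j : nat) == t]eq_sym (gtn_eqF lt_ji).
    case: eqP => // eq_tj; congr (op _ (drop_first _ _)).
    by apply: val_inj; rewrite /= jjE.
have j_gt0 : (0 < j)%N by exact: leq_trans le_ij.
have [jj jjE] : exists jj : 'I_n, jj.+1 = j :> nat.
  have ltn : (j.-1 < n)%N by rewrite prednK // -ltnS ltn_ord.
  by exists (Ordinal ltn); rewrite /= prednK.
exists jj, (contract a op i).
exists (fun u => if (j == i :> nat)%N then op (drop_last a jj) u else u).
  by case: eqP => // _; exact: opr.
move=> u; apply/funext => t /=; rewrite /contract drop_first_with drop_last_with.
rewrite -val_eqE /= -[in RHS]eqSS jjE.
case: (ltngtP t.+1 i) => [lt_ti|lt_it|eq_ti].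
- have lt_tj := leq_trans lt_ti le_ij.
  by rewrite (ltn_eqF lt_tj) ltn_eqF // ltnW.
- by case: eqP => // eq_tj; rewrite -eq_tj gtn_eqF.
- have lt_tj : (t < j)%N by rewrite eq_ti.
  rewrite (ltn_eqF lt_tj) eq_ti [(j : nat) == i]eq_sym.
  case: eqP => // eq_ij; congr (op (drop_last _ _) _).
  by apply: val_inj; apply: succn_inj; rewrite /= jjE -eq_ij.
Qed.

Lemma delta_multilinear n i (f : raw n) : multilinear f -> multilinear (delta i f).
Proof.
move=> fP y j a k u v; rewrite /delta.
have [op0l op0r] := dash_bilinear (left_trivial (sval y)).
have [opnl opnr] := dash_bilinear (~~ right_trivial (sval y)).
have [_|i_neq0] := eqVneq i 0.
  have [j'|] := unliftP ord0 j => ->.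
    have dE w : drop_first [eta a with fintype.lift ord0 j' |-> w]
                = [eta drop_first a with j' |-> w].
      apply/funext => t; rewrite drop_first_with /= -val_eqE.
      by rewrite /= /bump /= add1n eqSS.
    by rewrite !dE /= fP; exact: op0r.
  have dE w : drop_first [eta a with ord0 |-> w] = drop_first a.
    by apply/funext => t; rewrite drop_first_with.
  by rewrite !dE /=; exact: op0l.
have [i_len|_] := leqP i n.
  have ik : (0 < i <= n)%N by rewrite lt0n i_neq0.
  have [j' [c [g gP E]]] :=
    contract_with a j (dash_bilinear (left_leaning i (sval y))) ik.
  by rewrite !E gP fP.
have [j'|] := unliftP ord_max j => ->.
  have dE w : drop_last [eta a with fintype.lift ord_max j' |-> w]
              = [eta drop_last a with j' |-> w].
    apply/funext => t; rewrite drop_last_with /= -val_eqE.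
    by rewrite /= /bump leqNgt ltn_ord.
  by rewrite !dE /= (negbTE (neq_lift _ _)) fP; exact: opnl.
have dE w : drop_last [eta a with ord_max |-> w] = drop_last a.
  by apply/funext => t; rewrite drop_last_with ltn_eqF.
by rewrite !dE /= eqxx; exact: opnr.
Qed.

Lemma coboundary_subproof n (f : CY n) :
  coboundary_raw f \in @multilinear_pred n.+1.
Proof.
apply: rpred_sum => i _; apply: rpredZ; apply/asboolP/delta_multilinear.
by apply/asboolP; exact: (cochain_multilinear f).
Qed.

Definition coboundary n (f : CY n) : CY n.+1 := Cochain (coboundary_subproof f).

Lemma coboundary_linear n : linear (@coboundary n).
Proof. by move=> k f g; apply: val_inj; exact: coboundary_raw_linear. Qed.
HB.instance Definition _ n :=
  GRing.isLinear.Build K (CY n) (CY n.+1) _ (@coboundary n) (@coboundary_linear n).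

Definition cocycle_pred n : {pred CY n} := fun f => coboundary f == 0.

Lemma cocycle_submod n : submod_closed (@cocycle_pred n).
Proof.
split=> [|k f g /eqP f0 /eqP g0]; apply/eqP; first exact: linear0.
by rewrite coboundary_linear f0 g0 scaler0 addr0.
Qed.
HB.instance Definition _ n := GRing.isSubmodClosed.Build K (CY n)
  (@cocycle_pred n) (@cocycle_submod n).

Record cocycle n := Cocycle {
  cocycle_cochain :> CY n;
  cocycleP : cocycle_cochain \in @cocycle_pred n
}.
HB.instance Definition _ n := [isSub for @cocycle_cochain n].
HB.instance Definition _ n := [Choice of cocycle n by <:].
HB.instance Definition _ n := [SubChoice_isSubLmodule of cocycle n by <:].

Definition is_coboundary n : CY n -> Prop :=
  if n is m.+1 then fun f => exists g : CY m, f = coboundary g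
  else fun f => f = 0.

Definition coboundary_pred n : {pred cocycle n} := fun z => `[< is_coboundary z >].

Lemma coboundary_submod n : submod_closed (@coboundary_pred n).
Proof.
split=> [|k f g /asboolP fP /asboolP gP]; apply/asboolP.
  by case: n => [//|n]; exists 0; rewrite linear0.
case: n f g fP gP => [|n] f g /=; first by move=> -> ->; rewrite scaler0 addr0.
by move=> [f' ->] [g' ->]; exists (k *: f' + g'); rewrite linearP.
Qed.
HB.instance Definition _ n := GRing.isSubmodClosed.Build K (cocycle n)
  (@coboundary_pred n) (@coboundary_submod n).

Definition HY n : Type := lmod_quot (@coboundary_pred n).
HB.instance Definition _ n := GRing.Lmodule.on (HY n).

Definition coh_class n (z : cocycle n) : HY n := lmod_pi (@coboundary_pred n) z.

End Cohomology.

Definition pair_args (T : Type) (u v : T) : 'I_2 -> T :=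
  fun j => if j == ord0 then u else v.

Section Deformations.
Variables (K : fieldType) (D : lmodType K) (dD : dialgebra D).

Definition tens_act (A : comAlgType K) (a : A) : tensor A D -> tensor A D :=
  tens_lift (fun b d => tens (a * b) d).

Definition tens_map (A A' : comAlgType K) (phi : A -> A') :
  tensor A D -> tensor A' D := tens_lift (fun a d => tens (phi a) d).

(* [eps] tensored with the identity, K ⊗ D being identified with D. *)
Definition tens_aug (A : comAlgType K) (eps : A -> K^o) : tensor A D -> D :=
  tens_lift (fun a d => eps a *: d).

Definition base_bilinear (A : comAlgType K)
    (op : tensor A D -> tensor A D -> tensor A D) : Prop :=
  [/\ bilinear op,
      forall a x y, op (tens_act a x) y = tens_act a (op x y)
    & forall a x y, op x (tens_act a y) = tens_act a (op x y)].

Record deformation (A : comAlgType K) (eps : {lrmorphism A -> K^o}) := Deformation {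
  deform_dialg :> dialgebra (tensor A D);
  deform_ldash : base_bilinear (ldash deform_dialg);
  deform_rdash : base_bilinear (rdash deform_dialg);
  deform_aug : dialg_morphism deform_dialg dD (tens_aug eps)
}.

Definition equivalent (A : comAlgType K) (eps : {lrmorphism A -> K^o})
    (l l' : deformation eps) : Prop :=
  exists theta : tensor A D -> tensor A D,
    [/\ bijective theta,
        dialg_morphism l l' theta,
        forall a x, theta (tens_act a x) = tens_act a (theta x)
      & forall x, tens_aug eps (theta x) = tens_aug eps x].

(* [l'] is the push-out of [l] along [phi]: the element a' ⊗_A x of
   A' ⊗_A (A ⊗ D) corresponds to [tens_act a' (tens_map phi x)] in A' ⊗ D. *)
Definition is_pushout (A A' : comAlgType K) (eps : {lrmorphism A -> K^o})
    (eps' : {lrmorphism A' -> K^o}) (phi : {lrmorphism A -> A'})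
    (l : deformation eps) (l' : deformation eps') : Prop :=
  forall (a1 a2 : A') (x1 x2 : tensor A D),
    tens_act a1 (tens_map phi x1) ⊣[l'] tens_act a2 (tens_map phi x2)
      = tens_act (a1 * a2) (tens_map phi (x1 ⊣[l] x2)) /\
    tens_act a1 (tens_map phi x1) ⊢[l'] tens_act a2 (tens_map phi x2)
      = tens_act (a1 * a2) (tens_map phi (x1 ⊢[l] x2)).

Section Bilinearity.
Variables (A A' : comAlgType K).

Lemma tens_act_bilinear (a : A) : bilinear (fun b d => tens (a * b) d : tensor A D).
Proof.
have [tl tr] := @tens_bilinear K A D.
split=> [d k b b'|b k d d'] /=; last exact: tr.
by rewrite mulrDr -scalerAr; exact: tl.
Qed.

Lemma tens_map_bilinear (phi : {linear A -> A'}) :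
  bilinear (fun a d => tens (phi a) d : tensor A' D).
Proof.
have [tl tr] := @tens_bilinear K A' D.
split=> [d k b b'|b k d d'] /=; last exact: tr.
by rewrite linearP; exact: tl.
Qed.

Lemma tens_aug_bilinear (eps : {linear A -> K^o}) :
  bilinear (fun a (d : D) => eps a *: d).
Proof.
split=> [d k b b'|b k d d'] /=; last by rewrite scalerDr !scalerA mulrC.
by rewrite linearP scalerDl scalerA.
Qed.

Lemma tens_actE (a b : A) d : tens_act a (tens b d) = tens (a * b) d.
Proof. exact: tens_liftE (tens_act_bilinear a) b d. Qed.

Lemma tens_mapE (phi : {linear A -> A'}) a d :
  tens_map phi (tens a d) = tens (phi a) d.
Proof. exact: tens_liftE (tens_map_bilinear phi) a d. Qed.

Lemma tens_augE (eps : {linear A -> K^o}) a d :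
  tens_aug eps (tens a d) = eps a *: d.
Proof. exact: tens_liftE (tens_aug_bilinear eps) a d. Qed.

End Bilinearity.

Lemma pushout_unique (A A' : comAlgType K) (eps : {lrmorphism A -> K^o})
    (eps' : {lrmorphism A' -> K^o}) (phi : {lrmorphism A -> A'})
    (l : deformation eps) (l1 l2 : deformation eps') :
  is_pushout phi l l1 -> is_pushout phi l l2 ->
  forall x y, x ⊣[l1] y = x ⊣[l2] y /\ x ⊢[l1] y = x ⊢[l2] y.
Proof.
move=> P1 P2.
have gen a d : tens a d = tens_act a (tens_map phi (tens 1 d)).
  by rewrite tens_mapE tens_actE rmorph1 mulr1.
have tens_eq a d b e :
    tens a d ⊣[l1] tens b e = tens a d ⊣[l2] tens b e /\
    tens a d ⊢[l1] tens b e = tens a d ⊢[l2] tens b e.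
  rewrite (gen a d) (gen b e).
  by have [-> ->] := P1 a b (tens 1 d) (tens 1 e); have [-> ->] := P2 a b (tens 1 d) (tens 1 e).
have agree (f g : tensor A' D -> tensor A' D -> tensor A' D) :
    bilinear f -> bilinear g ->
    (forall a d b e, f (tens a d) (tens b e) = g (tens a d) (tens b e)) ->
    forall x y, f x y = g x y.
  move=> [fl fr] [gl gr] fg.
  have z0 (h : tensor A' D -> tensor A' D) : linear h -> h 0 = 0.
    by move=> hL; have := hL (-1) 0 0; rewrite scaler0 addr0 scaleN1r addNr.
  have add (h : tensor A' D -> tensor A' D) x y : linear h -> h (x + y) = h x + h y.
    by move=> hL; have := hL 1 x y; rewrite !scale1r.
  elim/tens_ind => [|a d x IHx] y.
    by rewrite [f 0 y](z0 (f^~ y)) // [g 0 y](z0 (g^~ y)).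
  rewrite [LHS](add (f^~ y)) // [RHS](add (g^~ y)) // IHx; congr (_ + _).
  elim/tens_ind: y => [|b e y IHy]; first by rewrite !z0.
  by rewrite !add // fg IHy.
move=> x y; split.
  by apply: (agree (ldash l1) (ldash l2)) => [||a d b e];
    [exact: ldash_bilinear | exact: ldash_bilinear | exact: (tens_eq a d b e).1].
by apply: (agree (rdash l1) (rdash l2)) => [||a d b e];
  [exact: rdash_bilinear | exact: rdash_bilinear | exact: (tens_eq a d b e).2].
Qed.

Lemma equivalent_refl A eps : reflexive (fun l l' => `[< @equivalent A eps l l' >]).
Proof. by move=> l; apply/asboolP; exists id; split=> //; exists id. Qed.

Lemma equivalent_sym A eps : symmetric (fun l l' => `[< @equivalent A eps l l' >]).
Proof.
have sym l l' : @equivalent A eps l l' -> equivalent l' l.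
  move=> [t [bij_t [tL tl tr] tA tE]]; have [s tK sK] := bij_t; exists s.
  have inj_t := bij_inj bij_t; split.
  - by exists t.
  - split=> [k x y|x y|x y]; apply: inj_t; first by rewrite tL !sK.
      by rewrite tl !sK.
    by rewrite tr !sK.
  - by move=> a x; apply: inj_t; rewrite tA !sK.
  - by move=> x; rewrite -tE sK.
by move=> l l'; apply: asbool_equiv_eq; split; exact: sym.
Qed.

Lemma equivalent_trans A eps : transitive (fun l l' => `[< @equivalent A eps l l' >]).
Proof.
move=> l2 l1 l3 /asboolP[t [bij_t [tL tl tr] tA tE]].
move=> /asboolP[s [bij_s [sL sl sr] sA sE]]; apply/asboolP; exists (s \o t); split.
- exact: bij_comp.
- by split=> [k x y|x y|x y] /=; rewrite ?tL ?tl ?tr ?sL ?sl ?sr.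
- by move=> a x /=; rewrite tA sA.
- by move=> x /=; rewrite sE tE.
Qed.

Section Lifts.
Variables (A B : comAlgType K) (eps : {lrmorphism A -> K^o}).
Variables (p : {lrmorphism B -> A}) (lam : deformation eps).

Record lifting := Lifting {
  lifting_deform :> deformation (eps \o p : {lrmorphism B -> K^o});
  lifting_pushout : is_pushout p lifting_deform lam
}.
HB.instance Definition _ := gen_eqMixin lifting.
HB.instance Definition _ := gen_choiceMixin lifting.

Definition lifting_equiv (m m' : lifting) : bool := `[< equivalent m m' >].

Lemma lifting_equiv_class : equiv_class_of lifting_equiv.
Proof.
split=> [m|m m'|m m' m'']; first exact: equivalent_refl.
  exact: equivalent_sym.
exact: equivalent_trans.
Qed.
Canonical lifting_equivRel := EquivRelPack lifting_equiv_class.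

Definition lifting_classes : Type := {eq_quot lifting_equiv}.
Definition lifting_class (m : lifting) : lifting_classes :=
  \pi_{eq_quot lifting_equiv} m.

Lemma lifting_classP (m m' : lifting) :
  lifting_class m = lifting_class m' <-> equivalent m m'.
Proof. by split=> [/eqmodP/asboolP|mm']; last exact/eqmodP/asboolP. Qed.

Variables (i : {linear K^o -> B}).

(* [mu'] is mu^psi; [I] is i ⊗ id, with K ⊗ D identified with D. *)
Definition is_twist (psi : cocycle dD 2) (mu mu' : lifting) : Prop :=
  let I d := tens (i 1) d in
  let E := tens_aug (eps \o p) in
  forall x y : tensor B D,
    x ⊣[mu'] y = x ⊣[mu] y + I (psi tree21 (pair_args (E x) (E y))) /\
    x ⊢[mu'] y = x ⊢[mu] y + I (psi tree12 (pair_args (E x) (E y))).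

End Lifts.

End Deformations.

(* Main.v *)
Require Import Defs.
From HB Require Import structures.
From mathcomp Require Import all_boot all_algebra.
From mathcomp Require Import boolp classical_sets functions.

Set Implicit Arguments.
Unset Strict Implicit.
Unset Printing Implicit Defensive.

Import GRing.Theory.
Local Open Scope ring_scope.

(** Tensoring 0 -> K -> B -> A -> 0 with D gives an exact sequence
    0 -> D -> B ⊗ D -> A ⊗ D -> 0, whose maps are called [emb] and P below; E is
    the augmentation B ⊗ D -> D.  For a deformation μ with base B, the element
    i(1) of B acts on B ⊗ D as [emb] after E, so that B-bilinearity forces
    (emb d) ∘ y = emb (d ∘ E y) and x ∘ (emb d) = emb (E x ∘ d) for each of the
    two products ([dash_embl], [dash_embr]): D sits in B ⊗ D as a square-zero
    ideal on which B ⊗ D acts through E.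

    Modify both products of μ by x ∘' y = x ∘ y + emb (ψ (E x, E y)).  By the
    above, each dialgebra axiom for the new products fails exactly by [emb] of
    one component of the coboundary δψ at (E x, E y, E z) ([twist_assoc]).  This
    uses a dictionary between the five trees of Y_3 and the five axioms: the tree
    y stands for a ∘_0 (b ∘_2 c) = (a ∘_1 b) ∘_3 c, with the operations ∘_j
    attached to y by the coboundary ([dash_assoc], [coboundary2E]).  Hence a
    cocycle twists liftings into liftings ([twist_exists]).

    The twist descends to classes.  If ψ - ψ' = δg then x |-> x + emb (g (E x))
    is an equivalence between the two twists ([twist_cohomologous]), and an
    equivalence of liftings fixes the image of [emb], so it is still an
    equivalence after twisting ([twist_equivalent]).

    The action is transitive because the products of two liftings μ and ν have
    the same image under P, so that they differ by [emb] of a B-bilinear map,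
    which has to factor through E ([aug_factor]), that is, by a ψ as above.
    Injectivity of [emb] then turns the axioms of ν into δψ = 0
    ([liftings_differ]). *)

(** * Linear maps on tensor products *)

HB.instance Definition _ (K : fieldType) (D : lmodType K) (dD : dialgebra D) b :=
  bilinear_isBilinear.Build K D D D _ _ (dash dD b) (dash_bilinear dD b).

HB.instance Definition _ (K : fieldType) (U V : lmodType K) :=
  bilinear_isBilinear.Build K U V (tensor U V) _ _ tens (tens_bilinear U V).

Section LinearMorphisms.
Variables (R : pzRingType) (U V : lmodType R) (f : U -> V).
Hypothesis fL : linear f.

Lemma linear_morphB : {morph f : x y / x - y}.
Proof. exact: zmod_morphism_linear. Qed.

Lemma linear_morph0 : f 0 = 0.
Proof. by rewrite -[0](subrr 0) linear_morphB subrr. Qed.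

Lemma linear_morphD : {morph f : x y / x + y}.
Proof. by move=> x y; have := fL 1 x y; rewrite !scale1r. Qed.

Lemma linear_morphZ k : {morph f : x / k *: x}.
Proof. by move=> x; have := fL k x 0; rewrite linear_morph0 !addr0. Qed.

End LinearMorphisms.

Lemma tens_ext (K : fieldType) (U V W : lmodType K) (f g : tensor U V -> W) :
    linear f -> linear g -> (forall u v, f (tens u v) = g (tens u v)) ->
  forall x, f x = g x.
Proof.
move=> fL gL fg; elim/tens_ind => [|u v x IHx].
  by rewrite (linear_morph0 fL) (linear_morph0 gL).
by rewrite (linear_morphD fL) (linear_morphD gL) fg IHx.
Qed.

Section TensorMaps.
Variables (K : fieldType) (D : lmodType K) (A A' : comAlgType K).

Lemma tens_act_linear (a : A) : linear (@tens_act K D A a).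
Proof. exact: tens_lift_linear (tens_act_bilinear D a). Qed.

Lemma tens_map_linear (phi : {linear A -> A'}) : linear (@tens_map K D A A' phi).
Proof. exact: tens_lift_linear (tens_map_bilinear D phi). Qed.

Lemma tens_aug_linear (e : {linear A -> K^o}) : linear (@tens_aug K D A e).
Proof. exact: tens_lift_linear (tens_aug_bilinear D e). Qed.

Lemma tens_act_mul (a b : A) (x : tensor A D) :
  tens_act a (tens_act b x) = tens_act (a * b) x.
Proof.
move: x; apply: tens_ext => [k u v||c d]; last by rewrite !tens_actE mulrA.
  by rewrite !tens_act_linear.
exact: tens_act_linear.
Qed.

Lemma tens_act1 (x : tensor A D) : tens_act 1 x = x.
Proof.
move: x; apply: tens_ext => [||c d]; [exact: tens_act_linear | by [] |].
by rewrite tens_actE mul1r.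
Qed.

End TensorMaps.

(** * Trees of low degree and the dialgebra axioms *)

Local Notation cherry := (Node Leaf Leaf).

(** The boolean follows the convention of [dash]: true stands for the product ⊣,
    to which the tree [21] belongs. *)
Definition tree2 (b : bool) : Y 2 := if b then tree21 else tree12.

Lemma nodes0 t : nodes t = 0 -> t = Leaf.
Proof. by case: t. Qed.

Lemma nodes1 t : nodes t = 1 -> t = cherry.
Proof.
case: t => //= l r [] /eqP; rewrite addn_eq0 => /andP[/eqP/nodes0->].
by move=> /eqP/nodes0->.
Qed.

Lemma nodes2 t : nodes t = 2 -> exists b, t = sval (tree2 b).
Proof.
case: t => //= l r []; case El: (nodes l) => [|[|n]] //=.
  by move: El => /nodes0-> /nodes1->; exists true.
by case=> /nodes0->; move: El => /nodes1->; exists false.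
Qed.

Lemma Y1_eq (y y' : Y 1) : y = y'.
Proof.
apply: val_inj; case: y => [t /eqP/nodes1 /= ->].
by case: y' => [t' /eqP/nodes1 /= ->].
Qed.

Lemma Y3_cases (y : Y 3) :
  [\/ exists b, sval y = Node Leaf (sval (tree2 b)),
      exists b, sval y = Node (sval (tree2 b)) Leaf
    | sval y = Node cherry cherry].
Proof.
case: y => t /= /eqP; case: t => //= l r [].
case El: (nodes l) => [|[|[|n]]] //=; move: El.
- by move=> /nodes0-> /nodes2[b ->]; constructor 1; exists b.
- by move=> /nodes1-> [] /nodes1->; constructor 3.
- by move=> /nodes2[b ->] [] /nodes0->; constructor 2; exists b.
Qed.

(** In the axiom a ∘_0 (b ∘_2 c) = (a ∘_1 b) ∘_3 c attached to y, the operations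
    0 and 2 occur together, and so do 1 and 3; deleting leaf i of y leaves the
    tree of the operation that occurs together with ∘_i. *)
Lemma face3E (y : Y 3) :
  [/\ face 0 y = tree2 (left_leaning 2 (sval y)),
      face 1 y = tree2 (~~ right_trivial (sval y)),
      face 2 y = tree2 (left_trivial (sval y))
    & face 3 y = tree2 (left_leaning 1 (sval y))].
Proof.
suff: [/\ del_leaf 0 (sval y) = sval (tree2 (left_leaning 2 (sval y))),
      del_leaf 1 (sval y) = sval (tree2 (~~ right_trivial (sval y))),
      del_leaf 2 (sval y) = sval (tree2 (left_trivial (sval y)))
    & del_leaf 3 (sval y) = sval (tree2 (left_leaning 1 (sval y)))].
  by case=> *; split; apply: val_inj.
by case: (Y3_cases y) => [[[] ->]|[[] ->]|->].
Qed.

Section DialgebraTrees.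
Variables (K : fieldType) (V : lmodType K).

(** The five dialgebra axioms are one axiom indexed by the five trees of Y_3. *)
Lemma dash_assoc (dV : dialgebra V) (y : Y 3) a b c :
  dash dV (left_trivial (sval y)) a (dash dV (left_leaning 2 (sval y)) b c) =
  dash dV (~~ right_trivial (sval y)) (dash dV (left_leaning 1 (sval y)) a b) c.
Proof.
case: (Y3_cases y) => [[[] ->]|[[] ->]|->] /=.
- exact: ldashA.
- by rewrite -ldash_bar.
- by rewrite rdash_bar.
- exact: rdashA.
- by rewrite dashA.
Qed.

Lemma dialgebra_of_trees (op : bool -> V -> V -> V) :
    (forall b, bilinear_for *:%R *:%R (op b)) ->
    (forall (y : Y 3) a b c,
      op (left_trivial (sval y)) a (op (left_leaning 2 (sval y)) b c) =
      op (~~ right_trivial (sval y)) (op (left_leaning 1 (sval y)) a b) c) ->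
  exists dV : dialgebra V, forall b, dash dV b = op b.
Proof.
move=> opL opA.
pose t3 t (ht : nodes t == 3) : Y 3 := exist (fun t => nodes t == 3) t ht.
have A1 := opA (t3 (Node Leaf (Node Leaf cherry)) isT).
have A2 := opA (t3 (Node Leaf (Node cherry Leaf)) isT).
have A3 := opA (t3 (Node cherry cherry) isT).
have A4 := opA (t3 (Node (Node Leaf cherry) Leaf) isT).
have A5 := opA (t3 (Node (Node cherry Leaf) Leaf) isT).
rewrite /= in A1 A2 A3 A4 A5.
exists (Dialgebra (opL true) (opL false) A1 (fun x y z => esym (A2 x y z))
  (fun x y z => esym (A3 x y z)) (fun x y z => esym (A4 x y z)) A5).
by case.
Qed.

End DialgebraTrees.

(** * Cochains of low degree *)

Section LowDegree.
Variables (K : fieldType) (D : lmodType K) (dD : dialgebra D).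

Definition cochain2_op (f : Y 2 -> ('I_2 -> D) -> D) (b : bool) (u v : D) : D :=
  f (tree2 b) (pair_args u v).

(** The coboundary of a 2-cochain, regarded as a pair of binary operations, at
    the tree y.  It is also the first-order variation of the axiom of y when the
    products of D are perturbed by g. *)
Definition cocycle_defect (g : bool -> D -> D -> D) (y : Y 3) (a b c : D) : D :=
  dash dD (left_trivial (sval y)) a (g (left_leaning 2 (sval y)) b c)
  - g (~~ right_trivial (sval y)) (dash dD (left_leaning 1 (sval y)) a b) c
  + g (left_trivial (sval y)) a (dash dD (left_leaning 2 (sval y)) b c)
  - dash dD (~~ right_trivial (sval y)) (g (left_leaning 1 (sval y)) a b) c.

Lemma args2E (T : Type) (a : 'I_2 -> T) : a = pair_args (a ord0) (a ord_max).
Proof.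
by apply/funext; case=> [[|[|k]] hk] //; rewrite /pair_args /=; congr a; apply: val_inj.
Qed.

Lemma coboundary1E (f : Y 1 -> ('I_1 -> D) -> D) (y : Y 1) b u v :
  let g w := f y (fun=> w) in
  cochain2_op (coboundary_raw dD f) b u v
    = dash dD b u (g v) - g (dash dD b u v) + dash dD b (g u) v.
Proof.
move=> g; rewrite /cochain2_op /coboundary_raw !big_ord_recl big_ord0.
(* Y_1 has a single element, so all three faces evaluate f at the same tree. *)
have gE y' a w : a ord0 = w -> f y' a = g w.
  by move=> <-; rewrite (Y1_eq y' y) /g; congr f; apply/funext => j; rewrite (ord1 j).
rewrite expr0 scale1r expr1 scaleN1r expr2 mulrNN mulr1 scale1r addr0 addrA.
rewrite -[LHS]/(delta dD 0 f (tree2 b) (pair_args u v)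
  - delta dD 1 f (tree2 b) (pair_args u v) + delta dD 2 f (tree2 b) (pair_args u v)).
rewrite /delta /first_dash /leaf_dash /last_dash /=.
rewrite !(gE _ (drop_first _) v) // !(gE _ (drop_last _) u) //.
by rewrite (gE _ _ (dash dD b u v)) //; case: b.
Qed.

Lemma coboundary2E (f : Y 2 -> ('I_2 -> D) -> D) (y : Y 3) (a : 'I_3 -> D) :
  coboundary_raw dD f y a
    = cocycle_defect (cochain2_op f) y (a ord0) (a (inord 1)) (a (inord 2)).
Proof.
rewrite /coboundary_raw !big_ord_recl big_ord0.
rewrite expr0 scale1r expr1 scaleN1r expr2 mulrNN mulr1 scale1r.
rewrite exprS expr2 mulrNN !mulr1 scaleN1r addr0 !addrA.
rewrite -[LHS]/(delta dD 0 f y a - delta dD 1 f y a + delta dD 2 f y a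
  - delta dD 3 f y a).
have aE k (hk : (k < 3)%N) : a (inord k) = a (Ordinal hk).
  by congr a; apply: val_inj; rewrite /= inordK.
have a0 : a ord0 = a (Ordinal (isT : 0 < 3)%N) by congr a; apply: val_inj.
rewrite (aE 1%N isT) (aE 2%N isT) a0.
rewrite /delta /first_dash /leaf_dash /last_dash /=.
have [-> -> -> ->] := face3E y.
rewrite /cocycle_defect /cochain2_op; congr (_ - _ + _ - _).
- congr (dash _ _ _ _); first by [].
  by rewrite [drop_first a]args2E; congr (f _ (pair_args _ _)); congr a; apply: val_inj.
- rewrite [contract _ _ _]args2E; congr (f _ (pair_args _ _)).
    by rewrite /contract /=; congr (dash _ _ _ _); congr a; apply: val_inj.
  by rewrite /contract /=; congr a; apply: val_inj.
- rewrite [contract _ _ _]args2E; congr (f _ (pair_args _ _)).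
    by rewrite /contract /=; congr a; apply: val_inj.
  by rewrite /contract /=; congr (dash _ _ _ _); congr a; apply: val_inj.
- congr (dash _ _ _ _); last by congr a; apply: val_inj.
  by rewrite [drop_last a]args2E; congr (f _ (pair_args _ _)); congr a; apply: val_inj.
Qed.

Lemma cochain2_op_bilinear (f : CY D 2) b : bilinear_for *:%R *:%R (cochain2_op f b).
Proof.
have /asboolP fM := cochain_multilinear f.
have wl u v w : [eta pair_args u v with ord0 |-> w] = pair_args w v :> ('I_2 -> D).
  by apply/funext => j; rewrite /= /pair_args; case: eqP.
have wr u v w : [eta pair_args u v with ord_max |-> w] = pair_args u w :> ('I_2 -> D).
  by apply/funext => j; rewrite /= /pair_args; case: j => [[|[|]]].
split=> [v k u u'|u k v v'] /=; rewrite /cochain2_op.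
  by have := fM (tree2 b) ord0 (pair_args 0 v) k u u'; rewrite !wl.
by have := fM (tree2 b) ord_max (pair_args u 0) k v v'; rewrite !wr.
Qed.

HB.instance Definition _ (f : CY D 2) b :=
  bilinear_isBilinear.Build K D D D _ _ (cochain2_op f b) (cochain2_op_bilinear f b).

Lemma cocycle2P (f : CY D 2) :
  reflect (forall y a b c, cocycle_defect (cochain2_op f) y a b c = 0)
          (f \in cocycle_pred dD (n:=2)).
Proof.
apply: (iffP eqP) => [f0 y a b c|f0]; last first.
  by apply: val_inj; apply/funext => y; apply/funext => a; rewrite /= coboundary2E f0.
have := coboundary2E f y (fun j => if j == 0 then a else if j == inord 1 then b else c).
rewrite -[coboundary_raw _ _]/(val (coboundary dD f)) f0 /= => /esym.
by rewrite -!val_eqE /= !inordK.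
Qed.

Lemma cochain2_of_op (g : bool -> D -> D -> D) :
    (forall b, bilinear_for *:%R *:%R (g b)) ->
  exists f : CY D 2, forall b, cochain2_op f b = g b.
Proof.
move=> gL.
(* [left_trivial] tells the two trees of Y_2 apart; it holds for [21]. *)
pose f (y : Y 2) (a : 'I_2 -> D) := g (left_trivial (sval y)) (a ord0) (a ord_max).
have fM : f \in multilinear_pred (K:=K) (D:=D) (n:=2).
  apply/asboolP => y j a k u v; rewrite /f.
  have [gl gr] := gL (left_trivial (sval y)).
  by case: j => [[|[|]]] // j2; [exact: gl | exact: gr].
by exists (Cochain fM) => -[]; apply/funext => u; apply/funext => v.
Qed.

Lemma cochain1_op_linear (f : CY D 1) y : linear (fun u => f y (fun=> u)).
Proof.
have /asboolP fM := cochain_multilinear f => k u v.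
have E w : (fun=> w) = [eta (fun _ : 'I_1 => 0 : D) with ord0 |-> w] :> ('I_1 -> D).
  by apply/funext => j; rewrite /= (ord1 j).
by have := fM y ord0 (fun=> 0) k u v; rewrite -!E.
Qed.

End LowDegree.

(** * Linear splittings of the extension *)

Section Splitting.
Variables (K : fieldType) (A B : comAlgType K).

(** A finite basis of A allows a section to be chosen on basis vectors. *)
Lemma linear_section (p : {linear B -> A}) :
    finite_dimensional A -> (forall a, exists b, p b = a) ->
  exists s : {linear A -> B}, cancel s p.
Proof.
move=> [n [[v vL [w vK wK]]]] psurj.
pose vl : {linear A -> 'rV[K]_n} := HB.pack v (GRing.isLinear.Build K A _ _ v vL).
have wL : linear w by exact: (can2_linear (f := vl)).
pose wl : {linear 'rV[K]_n -> A} := HB.pack w (GRing.isLinear.Build K _ A _ w wL).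
have [c cP] := choice (fun j : 'I_n => psurj (w (delta_mx 0 j))).
pose s a := \sum_(j < n) v a 0 j *: c j.
have sL : linear s.
  move=> k a a'; rewrite /s scaler_sumr -big_split /=; apply: eq_bigr => j _.
  by rewrite vL !mxE scalerDl scalerA.
pose sl : {linear A -> B} := HB.pack s (GRing.isLinear.Build K A B _ s sL).
exists sl => a; rewrite /sl /=.
rewrite /s linear_sum -[RHS]vK [v a in RHS]row_sum_delta -[w _]/(wl _) linear_sum.
by apply: eq_bigr => j _; rewrite !linearZ cP.
Qed.

Lemma extension_split (eps : {lrmorphism A -> K^o}) (i : {linear K^o -> B})
    (p : {lrmorphism B -> A}) :
    finite_dimensional A -> is_extension eps i p ->
  exists (r : {linear B -> K^o}) (s : {linear A -> B}),
    forall b, b = i (r b) + s (p b).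
Proof.
move=> Afin [iinj pker psurj _]; have [s sK] := linear_section Afin psurj.
have rex b : exists k, b - s (p b) = i k.
  by apply/pker; rewrite linearB sK subrr.
have [r rP] := choice rex.
have rL : linear (r : B -> K^o).
  move=> k b b'; apply: iinj.
  by rewrite -rP [RHS]linearP -!rP 2!linearP opprD scalerBr addrACA.
pose rl : {linear B -> K^o} :=
  HB.pack (r : B -> K^o) (GRing.isLinear.Build K B K^o _ r rL).
exists rl, s => b; rewrite /rl /=.
by rewrite -rP subrK.
Qed.

End Splitting.

(** * The square-zero ideal D of B ⊗ D *)

Section Twists.
Variables (K : fieldType) (D : lmodType K) (dD : dialgebra D).
Variables (A B : comAlgType K) (eps : {lrmorphism A -> K^o}).
Variables (lam : deformation dD eps) (i : {linear K^o -> B}) (p : {lrmorphism B -> A}).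
Hypothesis ext : is_extension eps i p.

Local Notation e := (eps \o p).
Local Notation E := (tens_aug e).
Local Notation P := (tens_map p).

Definition emb (d : D) : tensor B D := tens (i 1) d.

Lemma emb_linear : linear emb.
Proof. exact: (tens_bilinear B D).2. Qed.

Lemma aug_linear : linear (E : tensor B D -> D).
Proof. exact: tens_aug_linear. Qed.

Lemma map_linear : linear (P : tensor B D -> tensor A D).
Proof. exact: tens_map_linear. Qed.

Lemma i_scale k : i k = (k : K) *: (i 1 : B).
Proof. by rewrite -linearZ /= /GRing.scale /= mulr1. Qed.

Lemma mul_i1 b : b * i 1 = (eps (p b) : K) *: (i 1 : B).
Proof. by have [_ _ _ ->] := ext; rewrite -linearZ. Qed.

Lemma aug_pure b (d : D) : E (tens b d) = (eps (p b) : K) *: d.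
Proof. exact: tens_augE. Qed.

Lemma map_pure b (d : D) : P (tens b d) = tens (p b) d.
Proof. exact: tens_mapE. Qed.

Lemma aug_unit (d : D) : E (tens 1 d) = d.
Proof. by rewrite aug_pure !rmorph1 scale1r. Qed.

Lemma p_i1 : p (i 1) = 0.
Proof. by have [_ pker _ _] := ext; apply/pker; exists 1. Qed.

Lemma tens_aug_emb d : E (emb d) = 0.
Proof. by rewrite aug_pure p_i1 linear0 scale0r. Qed.

Lemma tens_map_emb d : P (emb d) = 0.
Proof. by rewrite map_pure p_i1 linear0l. Qed.

Lemma tens_act_emb b d : tens_act b (emb d) = emb ((eps (p b) : K) *: d).
Proof. by rewrite tens_actE mul_i1 linearZl_LR -linearZr_LR. Qed.

(** The reason why [emb] and the augmentation control all B-bilinear products: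
    multiplication by i(1) is [emb] after the augmentation. *)
Lemma tens_act_i1 (x : tensor B D) : tens_act (i 1) x = emb (E x).
Proof.
move: x; apply: tens_ext => [|k u v|b d]; first exact: tens_act_linear.
  by rewrite aug_linear emb_linear.
by rewrite tens_actE aug_pure mulrC mul_i1 linearZl_LR -linearZr_LR.
Qed.

Lemma tens_aug_act b (x : tensor B D) : E (tens_act b x) = (eps (p b) : K) *: E x.
Proof.
move: x; apply: tens_ext => [k u v|k u v|c d].
- by rewrite tens_act_linear aug_linear.
- by rewrite aug_linear scalerDr !scalerA mulrC.
by rewrite tens_actE !aug_pure /= !rmorphM scalerA.
Qed.

Lemma pure_act (b : B) (d : D) : tens b d = tens_act b (tens 1 d).
Proof. by rewrite tens_actE mulr1. Qed.

Lemma emb_act d : emb d = tens_act (i 1) (tens 1 d).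
Proof. exact: pure_act. Qed.

(** Exactness of 0 -> D -> B ⊗ D -> A ⊗ D, in split form: R is r ⊗ id for a
    linear retraction r of i. *)
Lemma emb_split : finite_dimensional A ->
  exists R : tensor B D -> D,
    [/\ linear R, cancel emb R & forall x, P x = 0 -> emb (R x) = x].
Proof.
move=> A_fin; have [r [s rs]] := extension_split A_fin ext.
have RL := @tens_aug_linear K D B r.
have SL := @tens_map_linear K D A B s.
have split_emb x : x = emb (tens_aug r x) + tens_map s (P x).
  move: x; apply: tens_ext => [//|k u v|b d].
    by rewrite RL emb_linear map_linear SL scalerDr addrACA.
  rewrite tens_augE map_pure tens_mapE (linear_morphZ emb_linear) {1}(rs b).
  by rewrite linearDl i_scale linearZl_LR.
exists (tens_aug r); split=> [//|d|x Px]; last first.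
  by rewrite [RHS]split_emb Px (linear_morph0 SL) addr0.
rewrite /emb tens_augE; have [iinj _ _ _] := ext.
suff -> : r (i 1) = 1 by rewrite scale1r.
by apply: iinj; rewrite [RHS]rs p_i1 linear0 addr0.
Qed.

(** B acts on the image of [emb] by scalars, through its augmentation, so that a
    B-linear map into this image cannot distinguish c ⊗ d from 1 ⊗ ε(c)d. *)
Lemma aug_factor (f : tensor B D -> tensor B D) :
    linear f -> (forall c x, f (tens_act c x) = tens_act c (f x)) ->
    (forall x, exists d, f x = emb d) ->
  forall x, f x = f (tens 1 (E x)).
Proof.
move=> fL fA fI; elim/tens_ind => [|c d x IHx].
  by rewrite (linear_morph0 aug_linear) linear0r.
rewrite (linear_morphD aug_linear) linearDr !(linear_morphD fL) -IHx.
congr (_ + _); have [k fk] := fI (tens 1 d).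
rewrite aug_pure pure_act fA fk tens_act_emb linearZr_LR (linear_morphZ fL) fk.
by rewrite (linear_morphZ emb_linear).
Qed.

Section Deform.
Variable mu : deformation dD (e : {lrmorphism B -> K^o}).

Lemma dash_actl b c x y : dash mu b (tens_act c x) y = tens_act c (dash mu b x y).
Proof.
by case: b; [have [_ + _] := deform_ldash mu | have [_ + _] := deform_rdash mu]; apply.
Qed.

Lemma dash_actr b c x y : dash mu b x (tens_act c y) = tens_act c (dash mu b x y).
Proof.
by case: b; [have [_ _] := deform_ldash mu | have [_ _] := deform_rdash mu]; apply.
Qed.

Lemma tens_aug_dash b x y : E (dash mu b x y) = dash dD b (E x) (E y).
Proof. by have [_ Hl Hr] := deform_aug mu; case: b; [exact: Hl | exact: Hr]. Qed.

Lemma dash_embl b d y : dash mu b (emb d) y = emb (dash dD b d (E y)).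
Proof.
by rewrite emb_act dash_actl tens_act_i1 tens_aug_dash aug_unit.
Qed.

Lemma dash_embr b x d : dash mu b x (emb d) = emb (dash dD b (E x) d).
Proof.
by rewrite emb_act dash_actr tens_act_i1 tens_aug_dash aug_unit.
Qed.

End Deform.

(** A deformation with base B pushes out to λ exactly when P is multiplicative,
    because B ⊗ D -> A ⊗ D becomes an isomorphism after extension of scalars. *)
Lemma pushoutP (mu : deformation dD (e : {lrmorphism B -> K^o})) :
  is_pushout p mu lam <->
  forall b x y, P (dash mu b x y) = dash lam b (P x) (P y).
Proof.
split=> [po [] x y|Pm a1 a2 x y].
- by have [+ _] := po 1 1 x y; rewrite mulr1 !tens_act1.
- by have [_ +] := po 1 1 x y; rewrite mulr1 !tens_act1.
have [_ ll lr] := deform_ldash lam; have [_ rl rr] := deform_rdash lam.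
by rewrite ll lr tens_act_mul rl rr tens_act_mul (Pm true) (Pm false).
Qed.

Lemma lifting_of_ops (op : bool -> tensor B D -> tensor B D -> tensor B D) :
    (forall b, bilinear_for *:%R *:%R (op b)) ->
    (forall b c x y, op b (tens_act c x) y = tens_act c (op b x y)) ->
    (forall b c x y, op b x (tens_act c y) = tens_act c (op b x y)) ->
    (forall (y : Y 3) u v w,
      op (left_trivial (sval y)) u (op (left_leaning 2 (sval y)) v w) =
      op (~~ right_trivial (sval y)) (op (left_leaning 1 (sval y)) u v) w) ->
    (forall b x y, E (op b x y) = dash dD b (E x) (E y)) ->
    (forall b x y, P (op b x y) = dash lam b (P x) (P y)) ->
  exists m : lifting p lam, forall b, dash m b = op b.
Proof.
move=> opL opl opr opA opE opP.
have [dV dVE] := dialgebra_of_trees opL opA.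
have baseP b : base_bilinear (dash dV b).
  by rewrite dVE; split; [exact: opL | exact: opl | exact: opr].
have augP : dialg_morphism dV dD E.
  split=> [|x y|x y]; first exact: tens_aug_linear.
  - by rewrite -[ldash dV]/(dash dV true) dVE opE.
  - by rewrite -[rdash dV]/(dash dV false) dVE opE.
pose m := @Deformation K D dD B e dV (baseP true) (baseP false) augP.
have po : is_pushout p m lam.
  by apply/pushoutP => b x y; rewrite -[deform_dialg m]/dV dVE opP.
by exists (Lifting po).
Qed.

(** * Twisting a lifting by a cocycle *)

Section Assoc.
Variables (mu : lifting p lam) (g : bool -> D -> D -> D).

Definition twist_op b (x y : tensor B D) := dash mu b x y + emb (g b (E x) (E y)).

Lemma tens_aug_twist b x y : E (twist_op b x y) = dash dD b (E x) (E y).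
Proof. by rewrite (linear_morphD aug_linear) tens_aug_emb addr0 tens_aug_dash. Qed.

(** Terms quadratic in g vanish since E kills [emb], and
    the terms linear in g are pulled out of the products by [dash_embl] and
    [dash_embr]. *)
Lemma twist_assoc (y : Y 3) u v w :
  twist_op (left_trivial (sval y)) u (twist_op (left_leaning 2 (sval y)) v w)
  - twist_op (~~ right_trivial (sval y)) (twist_op (left_leaning 1 (sval y)) u v) w
  = emb (cocycle_defect dD g y (E u) (E v) (E w)).
Proof.
have tw b x z := tens_aug_twist b x z; rewrite /twist_op in tw *; rewrite !tw.
rewrite linearDr linearDl /= dash_embl dash_embr dash_assoc.
rewrite /cocycle_defect (linear_morphB emb_linear) (linear_morphD emb_linear).
rewrite (linear_morphB emb_linear).
move: (dash mu _ _ _) (emb _) (emb _) (emb _) (emb _) => X b' a' c' d'.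
rewrite !opprD !addrA -[X + _ + _]addrA [X + _]addrC addrK.
by rewrite addrAC; congr (_ - _); rewrite addrAC.
Qed.

End Assoc.

Lemma is_twistP (psi : cocycle dD 2) (mu mu' : lifting p lam) :
  is_twist i psi mu mu' <->
  forall b x y, dash mu' b x y = twist_op mu (cochain2_op psi) b x y.
Proof.
split=> [tw [] x y|tw x y]; last by split; [exact: (tw true) | exact: (tw false)].
  by have [tl _] := tw x y; exact: tl.
by have [_ tr] := tw x y; exact: tr.
Qed.

Lemma twist_exists (psi : cocycle dD 2) (mu : lifting p lam) :
  exists mu' : lifting p lam, is_twist i psi mu mu'.
Proof.
have [m mE] : exists m : lifting p lam,
    forall b, dash m b = twist_op mu (cochain2_op psi) b.
  apply: lifting_of_ops.
  - move=> b; split=> [y|x] k u v; rewrite /twist_op.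
      by rewrite linearPl aug_linear linearPl emb_linear /= scalerDr addrACA.
    by rewrite linearPr aug_linear linearPr emb_linear /= scalerDr addrACA.
  - move=> b c x y; rewrite /twist_op dash_actl tens_aug_act linearZl_LR.
    by rewrite (linear_morphD (tens_act_linear c)) tens_act_emb.
  - move=> b c x y; rewrite /twist_op dash_actr tens_aug_act linearZr_LR.
    by rewrite (linear_morphD (tens_act_linear c)) tens_act_emb.
  - move=> y u v w; apply/eqP; rewrite -subr_eq0 twist_assoc; apply/eqP.
    by have /cocycle2P-> := cocycleP psi; rewrite (linear_morph0 emb_linear).
  - exact: tens_aug_twist.
  - move=> b x y; rewrite (linear_morphD map_linear) tens_map_emb addr0.
    by have /pushoutP := lifting_pushout mu.
by exists m; apply/is_twistP => b x y; rewrite mE.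
Qed.

Lemma equivalent_dash (mu nu : lifting p lam) (t : tensor B D -> tensor B D) :
    bijective t -> linear t ->
    (forall b x y, t (dash mu b x y) = dash nu b (t x) (t y)) ->
    (forall c x, t (tens_act c x) = tens_act c (t x)) ->
    (forall x, E (t x) = E x) ->
  equivalent mu nu.
Proof.
move=> tb tL tM tB tE; exists t; split=> //; split=> // x y.
  exact: (tM true).
exact: (tM false).
Qed.

(** If ψ - ψ' = δg, the equivalence is x |-> x + emb (g (E x)); its inverse changes
    the sign of g, since E kills [emb]. *)
Lemma twist_cohomologous (psi psi' : cocycle dD 2) (mu mu1 mu2 : lifting p lam) :
    coh_class psi = coh_class psi' ->
    is_twist i psi mu mu1 -> is_twist i psi' mu mu2 ->
  equivalent mu1 mu2.
Proof.
move=> /lmod_pi_eq/asboolP[h hE] /is_twistP tw1 /is_twistP tw2.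
pose y1 : Y 1 := face 0 tree12; pose g u := h y1 (fun=> u).
have gL : linear g := cochain1_op_linear h y1.
have psiE b u v : cochain2_op psi b u v + g (dash dD b u v) =
    dash dD b u (g v) + dash dD b (g u) v + cochain2_op psi' b u v.
  have dE : cochain2_op (coboundary_raw dD h) b u v
      = cochain2_op psi b u v - cochain2_op psi' b u v.
    by rewrite -[coboundary_raw dD h]/(val (coboundary dD h)) -hE.
  have := coboundary1E dD h y1 b u v; rewrite dE => /eqP; rewrite subr_eq => /eqP ->.
  by rewrite [LHS]addrAC; congr (_ + _); rewrite addrAC subrK.
have Eg x : E (x + emb (g (E x))) = E x.
  by rewrite (linear_morphD aug_linear) tens_aug_emb addr0.
have Eg' x : E (x - emb (g (E x))) = E x.
  by rewrite (linear_morphB aug_linear) tens_aug_emb subr0.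
apply: (equivalent_dash (t := fun x => x + emb (g (E x)))) => //.
- exists (fun x => x - emb (g (E x))) => x; first by rewrite Eg addrK.
  by rewrite Eg' subrK.
- by move=> k x y; rewrite aug_linear gL emb_linear scalerDr addrACA.
- move=> b x y; rewrite tw1 tens_aug_twist tw2 /twist_op !Eg.
  rewrite linearDl !linearDr /= !dash_embl !dash_embr tens_aug_emb linear0r.
  rewrite (linear_morph0 emb_linear) addr0 -!addrA -!(linear_morphD emb_linear).
  by rewrite psiE addrA.
- move=> c x; rewrite tens_aug_act (linear_morphZ gL) -tens_act_emb.
  by rewrite (linear_morphD (tens_act_linear c)).
Qed.

(** An equivalence fixes emb d = i(1)·(1 ⊗ d), because it is B-linear and
    i(1)·x depends only on E x; hence it carries the added terms to each other. *)
Lemma twist_equivalent (psi : cocycle dD 2) (mu nu mu' nu' : lifting p lam) :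
    equivalent mu nu -> is_twist i psi mu mu' -> is_twist i psi nu nu' ->
  equivalent mu' nu'.
Proof.
move=> [t [tb [tL tl tr] tB tE]] /is_twistP tw1 /is_twistP tw2.
apply: (equivalent_dash (t := t)) => // b x y.
have temb d : t (emb d) = emb d.
  by rewrite emb_act tB tens_act_i1 tE aug_unit emb_act.
rewrite tw1 tw2 /twist_op (linear_morphD tL) temb !tE; congr (_ + _).
by case: b; [exact: tl | exact: tr].
Qed.

(** * The difference of two liftings *)

Section Difference.
Variables mu nu : lifting p lam.

Definition dash_diff b x y := dash nu b x y - dash mu b x y.

Lemma dash_diff_bilinear b : bilinear_for *:%R *:%R (dash_diff b).
Proof.
split=> [y|x] k u v; rewrite /dash_diff.
  by rewrite !linearPl /= scalerBr opprD addrACA.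
by rewrite !linearPr /= scalerBr opprD addrACA.
Qed.

Lemma dash_diff_actl b c x y :
  dash_diff b (tens_act c x) y = tens_act c (dash_diff b x y).
Proof. by rewrite /dash_diff !dash_actl (linear_morphB (tens_act_linear c)). Qed.

Lemma dash_diff_actr b c x y :
  dash_diff b x (tens_act c y) = tens_act c (dash_diff b x y).
Proof. by rewrite /dash_diff !dash_actr (linear_morphB (tens_act_linear c)). Qed.

(** The operation ψ is read off on the elements 1 ⊗ d, and extends to all of B ⊗ D
    by [aug_factor].  That ψ is a cocycle is [twist_assoc] read backwards. *)
Lemma liftings_differ : finite_dimensional A ->
  exists psi : cocycle dD 2, is_twist i psi mu nu.
Proof.
move=> /emb_split[R [RL embK ker_emb]].
have diffE b x y : dash_diff b x y = emb (R (dash_diff b x y)).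
  rewrite ker_emb // (linear_morphB map_linear).
  have /pushoutP -> := lifting_pushout nu; have /pushoutP -> := lifting_pushout mu.
  by rewrite subrr.
have diff_aug b x y : dash_diff b x y = dash_diff b (tens 1 (E x)) (tens 1 (E y)).
  have [diffl diffr] := dash_diff_bilinear b.
  have -> := aug_factor (diffl y).
  - by apply: aug_factor => [|c z|z]; [exact: diffr | exact: dash_diff_actr | eexists].
  - by move=> c z; exact: dash_diff_actl.
  - by move=> z; eexists.
pose g b u v := R (dash_diff b (tens 1 u) (tens 1 v)).
have gL b : bilinear_for *:%R *:%R (g b).
  have [diffl diffr] := dash_diff_bilinear b.
  by split=> [v|u] k w w'; rewrite /g linearPr /= ?diffl ?diffr RL.
have nuE b x y : dash nu b x y = twist_op mu g b x y.
  by rewrite /twist_op /g -diffE -diff_aug addrC subrK.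
have [f fE] := cochain2_of_op gL.
have fc : f \in cocycle_pred dD (n:=2).
  apply/cocycle2P => y a b c; apply: (can_inj embK).
  have -> : cochain2_op f = g by apply/funext.
  rewrite -[a]aug_unit -[b]aug_unit -[c]aug_unit -(twist_assoc mu) -!nuE.
  by rewrite dash_assoc subrr (linear_morph0 emb_linear).
exists (Cocycle fc); apply/is_twistP => b x y; rewrite nuE.
by rewrite /twist_op -fE.
Qed.

End Difference.
End Twists.

Theorem proposition7p1
  (K : fieldType) (char0 : [pchar K] =i pred0)
  (D : lmodType K) (dD : dialgebra D)
  (A : comAlgType K) (A_fin : finite_dimensional A) (A_local : is_local A)
  (eps : {lrmorphism A -> K^o}) (lam : deformation dD eps)
  (B : comAlgType K) (i : {linear K^o -> B}) (p : {lrmorphism B -> A})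
  (ext : is_extension eps i p) :
  exists op : HY dD 2 -> lifting_classes p lam -> lifting_classes p lam,
    [/\ forall (psi : cocycle dD 2) (mu : lifting p lam),
          exists2 mu' : lifting p lam,
            is_twist i psi mu mu' &
            op (coh_class psi) (lifting_class mu) = lifting_class mu',
        forall x, op 0 x = x,
        forall g h x, op (g + h) x = op g (op h x)
      & forall x y, exists g, op g x = y].
Proof.
(* The action is defined by twisting representatives; [opE] then says that any
   other choice of representatives, and any twist, gives the same class. *)
pose rg (g : HY dD 2) : cocycle dD 2 := repr g.
have rgK g : coh_class (rg g) = g by exact: lmod_piK.
pose rx (x : lifting_classes p lam) : lifting p lam := repr x.
have rxK x : lifting_class (rx x) = x by exact: reprK.
pose tw g x := projT1 (cid (twist_exists ext (rg g) (rx x))).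
have twP g x : is_twist i (rg g) (rx x) (tw g x).
  by rewrite /tw; case: cid.
pose op g x := lifting_class (tw g x).
have opE psi mu mu' : is_twist i psi mu mu' ->
    op (coh_class psi) (lifting_class mu) = lifting_class mu'.
  move=> mumu'; apply/lifting_classP.
  have [nu munu] := twist_exists ext psi (rx (lifting_class mu)).
  have eq1 : equivalent (tw (coh_class psi) (lifting_class mu)) nu.
    by apply: twist_cohomologous (twP _ _) munu; rewrite ?rgK.
  have eq2 : equivalent nu mu'.
    by apply: twist_equivalent munu mumu' => //; apply/lifting_classP; rewrite rxK.
  apply/asboolP; apply: equivalent_trans; apply/asboolP; [exact: eq1 | exact: eq2].
exists op; split.
- move=> psi mu; have [mu' mumu'] := twist_exists ext psi mu.
  by exists mu' => //; apply: opE.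
- move=> x; rewrite -[x]rxK.
  have <- : coh_class (0 : cocycle dD 2) = 0 by exact: linear0.
  apply: opE; apply/is_twistP => b u v.
  rewrite /twist_op -[cochain2_op _ _ _ _]/(0 : D).
  by rewrite (linear_morph0 (emb_linear i)) addr0.
- move=> g h x; rewrite -[x]rxK -[g]rgK -[h]rgK.
  have [mu1 tw1] := twist_exists ext (rg h) (rx x).
  have [mu2 tw2] := twist_exists ext (rg g) mu1.
  rewrite (opE _ _ _ tw1) (opE _ _ _ tw2) -lmod_piD.
  apply: opE; apply/is_twistP => b u v.
  move/is_twistP in tw1; move/is_twistP in tw2.
  rewrite tw2 /twist_op tw1 /twist_op -addrA; congr (_ + _).
  rewrite -(linear_morphD (emb_linear i)) addrC; congr (emb i _).
- move=> x y; have [psi tw_psi] := liftings_differ ext (rx x) (rx y) A_fin.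
  by exists (coh_class psi); rewrite -[x]rxK -[y]rxK; apply: opE.
Qed.
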